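(* Given $L_f,L_g,D>0$. For any first-order algorithm $\mathcal A$ in the zero-respecting class (defined in the context) and any initial point $x_0$, there exists an $(L_f,L_g)$-smooth instance of the simple bilevel problem on the domain $\mathcal Z=\mathcal B(x_0,D)$ such that the optimal solution $x^*$ is contained in $\mathcal Z$ and $\mathcal A$ needs at least $$\Omega\left(\max\left\{\sqrt{\frac{L_f}{\epsilon_f}},\sqrt{\frac{L_g}{\epsilon_g}}\right\}D\right)$$ iterations to find an $(\epsilon_f,\epsilon_g)$-weak optimal solution.
   Context: Simple bilevel problem: minimize $f(x)$ over $x\in \mathcal X_g^*:=\arg\min_{z\in\mathcal Z} g(z)$, where $f,g:\mathbb R^n\to\mathbb R$ are convex and continuous and $\mathcal Z\subseteq\mathbb R^n$ is convex and compact. Let $f^*$ be its optimal value and $g^*=\min_{z\in\mathcal Z}g(z)$. The instance is $(L_f,L_g)$-smooth if $f$ is $L_f$-smooth and $g$ is $L_g$-smooth (differentiable with gradient Lipschitz with that constant in the Euclidean norm). For target accuracies $\epsilon_f,\epsilon_g>0$, a point $\hat x$ is an $(\epsilon_f,\epsilon_g)$-weak optimal solution if $f(\hat x)-f^*\le\epsilon_f$ and $g(\hat x)-g^*\le\epsilon_g$. $\mathcal B(x_0,D)=\{y:\|y-x_0\|_2\le D\}$. Zero-respecting class: with $\mathrm{supp}(x)=\{j:x_{[j]}\ne0\}$ (nonzero coordinates), an iterative method $\mathcal A$ can access $f$ and $g$ only through a first-order black-box oracle, which takes a test point $\hat x$ as input and returns $\partial f(\hat x),\partial g(\hat x)$,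 denoting arbitrary subgradients of $f$ and $g$ at $\hat x$ (gradients in the differentiable case). $\mathcal A$ generates a sequence of test points $x_0,x_1,x_2,\dots$ with $$\mathrm{supp}(x_{k+1})\subseteq \mathrm{supp}(x_0)\cup\left(\bigcup_{0\le s\le k}\mathrm{supp}(\partial f(x_s))\cup\mathrm{supp}(\partial g(x_s))\right).$$ The dimension $n$ is part of the instance and may depend on the accuracies and the other parameters. $\Omega$ is the usual asymptotic lower-bound notation, hiding only a universal constant. *)

(* Defs.v *)
From HB Require Import structures.
From mathcomp Require Import all_boot all_order all_algebra.
From mathcomp Require Import all_classical all_reals all_analysis.

Set Implicit Arguments.
Unset Strict Implicit.
Unset Printing Implicit Defensive.

Import Order.TTheory GRing.Theory Num.Theory.
Import numFieldNormedType.Exports.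

Local Open Scope classical_set_scope.
Local Open Scope ring_scope.

(* The library norm on 'rV[R]_n is the sup norm, hence a separate Euclidean
   norm. Both give the same topology, so the library's notions of continuity,
   differentiability and compactness are the usual ones. *)
Definition l2norm (R : realType) (n : nat) (x : 'rV[R]_n) : R :=
  Num.sqrt (\sum_(j < n) x ord0 j ^+ 2).

Definition l2ball (R : realType) (n : nat) (x0 : 'rV[R]_n) (D : R)
    : set 'rV[R]_n :=
  [set y | l2norm (y - x0) <= D].

Definition gradient (R : realType) (n : nat) (f : 'rV[R]_n -> R)
    (x : 'rV[R]_n) : 'rV[R]_n :=
  \row_(j < n) 'D_(delta_mx ord0 j) f x.

Definition smooth_function (R : realType) (n : nat) (L : R)
    (f : 'rV[R]_n -> R) : Prop :=
  (forall x, differentiable f x) /\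
  (forall x y, l2norm (gradient f x - gradient f y) <= L * l2norm (x - y)).

Definition argmin_on (R : realType) (n : nat) (Z : set 'rV[R]_n)
    (h : 'rV[R]_n -> R) : set 'rV[R]_n :=
  [set x | Z x /\ forall z, Z z -> h x <= h z].

Definition opt_value (R : realType) (n : nat) (Z : set 'rV[R]_n)
    (h : 'rV[R]_n -> R) : R :=
  inf [set h x | x in Z].

Definition bilevel_instance (R : realType) (n : nat) (f g : 'rV[R]_n -> R)
    (Z : set 'rV[R]_n) : Prop :=
  [/\ convex_function [set: 'rV[R]_n] f /\ continuous f,
      convex_function [set: 'rV[R]_n] g /\ continuous g,
      convex_set Z &
      compact Z].

Definition smooth_bilevel_instance (R : realType) (n : nat) (Lf Lg : R)
    (f g : 'rV[R]_n -> R) (Z : set 'rV[R]_n) : Prop :=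
  [/\ bilevel_instance f g Z, smooth_function Lf f & smooth_function Lg g].

Definition bilevel_optimal (R : realType) (n : nat) (f g : 'rV[R]_n -> R)
    (Z : set 'rV[R]_n) (x : 'rV[R]_n) : Prop :=
  argmin_on (argmin_on Z g) f x.

Definition weak_optimal (R : realType) (n : nat) (ef eg : R)
    (f g : 'rV[R]_n -> R) (Z : set 'rV[R]_n) (x : 'rV[R]_n) : Prop :=
  f x - opt_value (argmin_on Z g) f <= ef /\ g x - opt_value Z g <= eg.

(* A (deterministic) first-order method on R^n: it maps the non-empty list of
   past oracle calls (test point, gradient of f, gradient of g), oldest first,
   to the next test point. *)
Definition oracle_call (R : realType) (n : nat) : Type :=
  ('rV[R]_n * 'rV[R]_n * 'rV[R]_n)%type.

Definition first_order_method (R : realType) (n : nat) : Type :=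
  seq (oracle_call R n) -> 'rV[R]_n.

Definition query (R : realType) (n : nat) (f g : 'rV[R]_n -> R)
    (x : 'rV[R]_n) : oracle_call R n :=
  (x, gradient f x, gradient g x).

Fixpoint transcript (R : realType) (n : nat) (A : first_order_method R n)
    (f g : 'rV[R]_n -> R) (x0 : 'rV[R]_n) (k : nat) : seq (oracle_call R n) :=
  if k is k'.+1 then
    let h := transcript A f g x0 k' in rcons h (query f g (A h))
  else [:: query f g x0].

Definition test_point (R : realType) (n : nat) (A : first_order_method R n)
    (f g : 'rV[R]_n -> R) (x0 : 'rV[R]_n) (k : nat) : 'rV[R]_n :=
  if k is k'.+1 then A (transcript A f g x0 k') else x0.

Definition supp (R : realType) (n : nat) (x : 'rV[R]_n) : set 'I_n :=
  [set j | x ord0 j != 0].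

Definition zero_respecting (R : realType) (n : nat)
    (A : first_order_method R n) : Prop :=
  forall (f g : 'rV[R]_n -> R) (x0 : 'rV[R]_n),
    convex_function [set: 'rV[R]_n] f -> (forall x, differentiable f x) ->
    convex_function [set: 'rV[R]_n] g -> (forall x, differentiable g x) ->
    let x := test_point A f g x0 in
    forall k : nat,
      supp (x k.+1) `<=`
        supp x0 `|`
        \bigcup_(s in [set s : nat | (s <= k)%N])
          (supp (gradient f (x s)) `|` supp (gradient g (x s))).

(* Main.v *)
Require Import Defs.
From HB Require Import structures.
From mathcomp Require Import all_boot all_order all_algebra.
From mathcomp Require Import all_classical all_reals all_analysis.
From mathcomp Require Import ring lra.

Set Implicit Arguments.
Unset Strict Implicit.
Unset Printing Implicit Defensive.

Import Order.TTheory GRing.Theory Num.Theory.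
Import numFieldNormedType.Exports.

Local Open Scope classical_set_scope.
Local Open Scope ring_scope.

(** The objective used for the level attaining the maximum is Nesterov's chain
    [L/8 * ((y_0 - b)^2 + \sum_i (y_(i+1) - y_i)^2)] with
    [y_i = <v_i, x - x0>] for orthonormal directions [v_0, .., v_m]; the other
    objective is zero. The chain vanishes at [y_i = b] for all [i], which lies
    on the sphere of radius [D] when [b = D / sqrt (m+1)], and by
    Cauchy-Schwarz it is at least [L D^2 / (8 (m+1)^2)] wherever [y_m = 0].
    Since [x0] may have full support, coordinate directions would not do, and
    the [v_i] are chosen adaptively: the gradient at a point with
    [y_j = 0] for all [j >= s] involves only [v_0, .., v_s], so the first
    [i + 1] test points are known once [v_0, .., v_(i-1)] are, and [v_i] can be
    taken orthogonal to all of them. Dimension [2 (m+1)] leaves enough room. *)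

(** * Euclidean inner product *)

Definition dot (R : realType) (n : nat) (x y : 'rV[R]_n) : R :=
  (x *m y^T) ord0 ord0.

Lemma dotE (R : realType) (n : nat) (x y : 'rV[R]_n) :
  dot x y = \sum_(j < n) x ord0 j * y ord0 j.
Proof. by rewrite /dot mxE; apply: eq_bigr => j _; rewrite mxE. Qed.

Lemma dotC (R : realType) (n : nat) (x y : 'rV[R]_n) : dot x y = dot y x.
Proof. by rewrite !dotE; apply: eq_bigr => j _; rewrite mulrC. Qed.

Lemma dotDl (R : realType) (n : nat) (x y z : 'rV[R]_n) :
  dot (x + y) z = dot x z + dot y z.
Proof. by rewrite /dot mulmxDl mxE. Qed.

Lemma dotZl (R : realType) (n : nat) (a : R) (x y : 'rV[R]_n) :
  dot (a *: x) y = a * dot x y.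
Proof. by rewrite /dot -scalemxAl mxE. Qed.

Lemma dotBl (R : realType) (n : nat) (x y z : 'rV[R]_n) :
  dot (x - y) z = dot x z - dot y z.
Proof. by rewrite -scaleN1r dotDl dotZl mulN1r. Qed.

Lemma dot0l (R : realType) (n : nat) (x : 'rV[R]_n) : dot 0 x = 0.
Proof. by rewrite /dot mul0mx mxE. Qed.

Lemma dot_suml (R : realType) (n : nat) (I : Type) (r : seq I) (P : pred I)
    (F : I -> 'rV[R]_n) (y : 'rV[R]_n) :
  dot (\sum_(i <- r | P i) F i) y = \sum_(i <- r | P i) dot (F i) y.
Proof. by rewrite /dot mulmx_suml summxE. Qed.

Lemma dotDr (R : realType) (n : nat) (x y z : 'rV[R]_n) :
  dot x (y + z) = dot x y + dot x z.
Proof. by rewrite !(dotC x) dotDl. Qed.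

Lemma dotZr (R : realType) (n : nat) (a : R) (x y : 'rV[R]_n) :
  dot x (a *: y) = a * dot x y.
Proof. by rewrite !(dotC x) dotZl. Qed.

Lemma dotBr (R : realType) (n : nat) (x y z : 'rV[R]_n) :
  dot x (y - z) = dot x y - dot x z.
Proof. by rewrite !(dotC x) dotBl. Qed.

Lemma dot_sumr (R : realType) (n : nat) (I : Type) (r : seq I) (P : pred I)
    (F : I -> 'rV[R]_n) (x : 'rV[R]_n) :
  dot x (\sum_(i <- r | P i) F i) = \sum_(i <- r | P i) dot x (F i).
Proof. by rewrite dotC dot_suml; apply: eq_bigr => i _; rewrite dotC. Qed.

Lemma dotxx_ge0 (R : realType) (n : nat) (x : 'rV[R]_n) : 0 <= dot x x.
Proof. by rewrite dotE; apply: sumr_ge0 => j _; rewrite -expr2 sqr_ge0. Qed.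

Lemma dotxx_eq0 (R : realType) (n : nat) (x : 'rV[R]_n) :
  (dot x x == 0) = (x == 0).
Proof.
apply/eqP/eqP => [|->]; last by rewrite dot0l.
rewrite dotE => /eqP; rewrite psumr_eq0; last first.
  by move=> j _; rewrite -expr2 sqr_ge0.
move=> /allP x0; apply/rowP => j; rewrite mxE; apply/eqP.
by rewrite -sqrf_eq0 expr2; apply: (implyP (x0 j (mem_index_enum j))).
Qed.

Lemma l2normE (R : realType) (n : nat) (x : 'rV[R]_n) :
  l2norm x = Num.sqrt (dot x x).
Proof.
by rewrite /l2norm dotE; congr Num.sqrt; apply: eq_bigr => j _; rewrite expr2.
Qed.

Lemma l2norm_le (R : realType) (n : nat) (x : 'rV[R]_n) (D : R) :
  0 <= D -> (l2norm x <= D) = (dot x x <= D ^+ 2).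
Proof.
move=> D0; rewrite l2normE -[in LHS](ger0_norm D0) -sqrtr_sqr.
by rewrite ler_sqrt // sqr_ge0.
Qed.

Lemma dot_linear (R : realType) (n : nat) (u : 'rV[R]_n) :
  linear (dot u : 'rV[R]_n -> R).
Proof. by move=> a x y; rewrite dotDr dotZr. Qed.

Lemma dot_continuous (R : realType) (n : nat) (u : 'rV[R]_n) :
  continuous (dot u).
Proof.
have -> : dot u = fun x => \sum_(j < n) u ord0 j * x ord0 j.
  by apply/funext => x; rewrite dotE.
apply: continuous_big => [|j _]; first exact: add_continuous.
move=> x; exact: (continuous_comp (@coord_continuous _ _ _ ord0 j x)
  (@mulrl_continuous _ (u ord0 j) _)).
Qed.

Lemma is_diff_dot (R : realType) (n : nat) (u x : 'rV[R]_n) :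
  is_diff x (dot u) (dot u).
Proof.
pose l := GRing.isLinear.Build R 'rV[R]_n R *%R (dot u) (@dot_linear R n u).
pose f : {linear 'rV[R]_n -> R} := HB.pack (dot u) l.
apply: DiffDef.
  exact: (@linear_differentiable _ _ _ f x (@dot_continuous R n u)).
exact: (@diff_lin _ _ _ f x (@dot_continuous R n u)).
Qed.

(** * Least-squares objectives: gradient and convexity *)

(** This one family covers the chain, the single-term objective of [one_step_hard] and the squared
    distance to [x0]. *)
Definition least_squares (R : realType) (n m : nat) (a : R)
    (u : nat -> 'rV[R]_n) (c : nat -> R) (x0 x : 'rV[R]_n) : R :=
  a * \sum_(i < m) (dot (u i) (x - x0) - c i) ^+ 2.

(** Writing the differential as [dot] of a fixed vector lets the gradient be read off
    coordinatewise. *)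
Lemma is_diff_least_squares (R : realType) (n m : nat) (a : R)
    (u : nat -> 'rV[R]_n) (c : nat -> R) (x0 x : 'rV[R]_n) :
  is_diff x (least_squares m a u c x0)
    (dot (\sum_(i < m) (2 * a * (dot (u i) (x - x0) - c i)) *: u i)).
Proof.
pose t i : 'rV[R]_n -> R := fun x => dot (u i) (x - x0) - c i.
have dt i : is_diff x (t i) (dot (u i)).
  have -> : t i = dot (u i) - cst (dot (u i) x0 + c i).
    by apply/funext => y; rewrite /t dotBr /= opprD addrA.
  rewrite -[X in is_diff _ _ X]subr0.
  by apply: is_diffB; first exact: is_diff_dot.
elim: m => [|m IH].
  rewrite big_ord0; have -> : dot (0 : 'rV[R]_n) = cst 0.
    by apply/funext => y; rewrite dot0l.
  have -> : least_squares 0 a u c x0 = cst 0.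
    by apply/funext => y; rewrite /least_squares big_ord0 mulr0.
  exact: is_diff_cst.
have -> : least_squares m.+1 a u c x0 =
    least_squares m a u c x0 + a *: (t m) ^+ 2.
  apply/funext => y; rewrite /least_squares big_ord_recr mulrDr; congr (_ + _).
rewrite big_ord_recr /=.
set s := \sum_(i < m) _ in IH *.
have -> : dot (s + (2 * a * t m x) *: u m) =
    dot s + a *: ((2 * t m x ^+ 1) *: dot (u m)).
  apply/funext => y; rewrite dotDl dotZl expr1; congr (_ + _).
  change (2 * a * t m x * dot (u m) y = a * (2 * t m x * dot (u m) y)); ring.
by apply: is_diffD => //; apply: is_diffZ; apply: is_diffX.
Qed.

Lemma differentiable_least_squares (R : realType) (n m : nat) (a : R)
    (u : nat -> 'rV[R]_n) (c : nat -> R) (x0 x : 'rV[R]_n) :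
  differentiable (least_squares m a u c x0) x.
Proof. by have [] := is_diff_least_squares m a u c x0 x. Qed.

Lemma gradient_least_squares (R : realType) (n m : nat) (a : R)
    (u : nat -> 'rV[R]_n) (c : nat -> R) (x0 x : 'rV[R]_n) :
  gradient (least_squares m a u c x0) x =
  \sum_(i < m) (2 * a * (dot (u i) (x - x0) - c i)) *: u i.
Proof.
have D := is_diff_least_squares m a u c x0 x.
apply/rowP => j; rewrite mxE deriveE; last exact: differentiable_least_squares.
rewrite diff_val; move: (\sum_(i < m) _) => s.
rewrite dotE (bigD1 j) //= big1 => [|i ij]; rewrite [delta_mx _ _ _ _]mxE eqxx.
  by rewrite eqxx mulr1 addr0.
by rewrite (negbTE ij) mulr0.
Qed.

Lemma convex_functionT (R : realType) (n : nat) (f : 'rV[R]_n -> R) :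
  (forall t x y, 0 <= t <= 1 ->
    f (t *: x + (1 - t) *: y) <= t * f x + (1 - t) * f y) ->
  convex_function [set: 'rV[R]_n] f.
Proof.
by move=> cf t x y _ _; apply: cf; rewrite ge0 le1.
Qed.

Lemma convex_least_squares (R : realType) (n m : nat) (a : R)
    (u : nat -> 'rV[R]_n) (c : nat -> R) (x0 : 'rV[R]_n) : 0 <= a ->
  convex_function [set: 'rV[R]_n] (least_squares m a u c x0).
Proof.
move=> a0; apply: convex_functionT => t x y /andP[t0 t1].
rewrite /least_squares !(mulrCA _ a) -mulrDr ler_wpM2l // !mulr_sumr -big_split.
apply: ler_sum => i _ /=; rewrite !dotBr dotDr !dotZr.
move: (dot _ x) (dot _ y) (dot _ x0) (c i) => p q r s.
rewrite -subr_ge0.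
have -> : t * (p - r - s) ^+ 2 + (1 - t) * (q - r - s) ^+ 2 -
    (t * p + (1 - t) * q - r - s) ^+ 2 = t * (1 - t) * (p - q) ^+ 2 by ring.
apply: mulr_ge0 (sqr_ge0 _); apply: mulr_ge0 => //; by rewrite subr_ge0.
Qed.

(** * The Euclidean ball is convex and compact *)

Lemma l2ball_convex (R : realType) (n : nat) (x0 : 'rV[R]_n) (D : R) :
  0 <= D -> convex_set (l2ball x0 D).
Proof.
move=> D0 x y t; rewrite !inE /l2ball /= !l2norm_le // => xD yD.
have t0 : 0 <= t%:num by rewrite ge0.
have t1 : 0 <= 1 - t%:num by rewrite subr_ge0 le1.
change (dot (t%:num *: x + (1 - t%:num) *: y - x0)
  (t%:num *: x + (1 - t%:num) *: y - x0) <= D ^+ 2).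
move: t0 t1; move: (t%:num) => s s0 s1.
have -> : s *: x + (1 - s) *: y - x0 = s *: (x - x0) + (1 - s) *: (y - x0).
  by apply/rowP => j; rewrite !mxE; ring.
move: xD yD; move: (x - x0) (y - x0) => {}x {}y xD yD.
(* The squared norm of [s *: x + (1 - s) *: y] is the weighted mean of the squared norms minus
   [s * (1 - s) * dot (x - y) (x - y)]. *)
have xy := dotxx_ge0 (x - y).
have := ler_wpM2l s0 xD; have := ler_wpM2l s1 yD.
have := mulr_ge0 (mulr_ge0 s0 s1) xy.
rewrite !(dotBl, dotBr, dotDl, dotDr, dotZl, dotZr) (dotC y x).
by move: (dot x x) (dot y y) (dot x y) => p q r; nra.
Qed.

Lemma l2ball_compact (R : realType) (n : nat) (x0 : 'rV[R]_n) (D : R) :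
  0 <= D -> compact (l2ball x0 D).
Proof.
move=> D0; apply: bounded_closed_compact.
  exists (`|x0| + D); split; first exact: num_real.
  move=> M ltM x /=; rewrite /l2ball /= l2norm_le // => xD.
  apply: le_trans (ltW ltM); rewrite -[x](subrK x0) addrC.
  apply: le_trans (ler_normD _ _) _; rewrite lerD2l.
  (* The sup norm is attained at some coordinate, whose square is at most [dot y y]. *)
  move: (x - x0) xD => y yD; have [->|] := eqVneq `|y| 0; first by [].
  change (mx_norm y != 0 -> mx_norm y <= D).
  move=> /mx_norm_neq0[[i j]] /= ->; rewrite (ord1 i).
  rewrite -(@ler_pXn2r _ 2) ?nnegrE // -normrX ger0_norm ?sqr_ge0 //.
  apply: le_trans yD; rewrite dotE (bigD1 j) //= -expr2 lerDl.
  by apply: sumr_ge0 => k _; rewrite -expr2 sqr_ge0.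
(* For closedness, the ball is a sublevel set of the squared distance, a [least_squares] over the
   standard basis and hence continuous. *)
pose e k : 'rV[R]_n := \row_j (j == k :> nat)%:R.
have eE (j : 'I_n) y : dot (e j) y = y ord0 j.
  rewrite dotE (bigD1 j) //= mxE eqxx mul1r big1 ?addr0 // => i ij.
  by rewrite mxE (inj_eq val_inj) (negbTE ij) mul0r.
have -> : l2ball x0 D =
    least_squares n 1 e (fun=> 0) x0 @^-1` [set r | r <= D ^+ 2].
  have E x : least_squares n 1 e (fun=> 0) x0 x = dot (x - x0) (x - x0).
    rewrite /least_squares mul1r dotE; apply: eq_bigr => j _.
    by rewrite eE subr0 expr2.
  by apply/seteqP; split => x; rewrite /l2ball /= E l2norm_le.
apply: preimage_closed; last exact: closed_le.
by move=> x _; exact/differentiable_continuous/differentiable_least_squares.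
Qed.

(** * Orthonormal families *)

(** The matrix with columns [w j] has rank at most [k < n], so its left kernel contains a nonzero
    vector, which is then normalized. *)
Lemma exists_orthogonal_unit (R : realType) (n k : nat) (w : nat -> 'rV[R]_n) :
  (k < n)%N ->
  exists z : 'rV[R]_n,
    dot z z = 1 /\ forall j, (j < k)%N -> dot (w j) z = 0.
Proof.
move=> kn; pose W : 'M[R]_(n, k) := \matrix_(i, j) w j ord0 i.
have /rowV0Pn[z zW z0] : kermx W != 0.
  by rewrite -mxrank_eq0 mxrank_ker subn_eq0 -ltnNge (leq_ltn_trans (rank_leq_col W)).
have zz0 : 0 < dot z z by rewrite lt_neqAle eq_sym dotxx_eq0 z0 dotxx_ge0.
exists ((Num.sqrt (dot z z))^-1 *: z); split.
  rewrite dotZl dotZr mulrA -invfM -expr2 sqr_sqrtr ?ltW //.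
  by rewrite mulVf // gt_eqF.
move=> j jk; rewrite dotZr; have /sub_kermxP/rowP/(_ (Ordinal jk)) := zW.
rewrite !mxE => zw; rewrite (_ : dot (w j) z = 0) ?mulr0 // dotC dotE.
by rewrite -[RHS]zw; apply: eq_bigr => i _; rewrite mxE.
Qed.

(** Sequences indexed by [nat] let a partly chosen family be extended without changing its type;
    entries from [m] on are unconstrained. *)
Definition orthonormal_prefix (R : realType) (n m : nat)
    (v : nat -> 'rV[R]_n) : Prop :=
  forall i j, (i < m)%N -> (j < m)%N -> dot (v i) (v j) = (i == j)%:R.

(** With [p] the projection of [z], both [dot p z] and [dot p p] equal the left side; expand
    [0 <= dot (z - p) (z - p)]. *)
Lemma bessel_inequality (R : realType) (n m : nat) (v : nat -> 'rV[R]_n)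
    (z : 'rV[R]_n) : orthonormal_prefix m v ->
  \sum_(i < m) dot (v i) z ^+ 2 <= dot z z.
Proof.
move=> vP; pose p := \sum_(i < m) dot (v i) z *: v i.
have pz : dot p z = \sum_(i < m) dot (v i) z ^+ 2.
  by rewrite dot_suml; apply: eq_bigr => i _; rewrite dotZl expr2.
have pp : dot p p = \sum_(i < m) dot (v i) z ^+ 2.
  rewrite {1}/p dot_suml; apply: eq_bigr => i _; rewrite dotZl expr2.
  congr (_ * _); rewrite /p dot_sumr (bigD1 i) //= big1 => [|j ji].
    by rewrite dotZr vP // eqxx mulr1 addr0.
  rewrite dotZr vP // (inj_eq val_inj) eq_sym (negbTE ji) mulr0 //.
have := dotxx_ge0 (z - p).
rewrite !(dotBl, dotBr) (dotC z p) pz pp; lra.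
Qed.

(** * The chain and its smoothness constant *)

(** Increments under the convention that the direction before [v 0] is zero; offset [b] at index 0
    and 0 elsewhere gives the chain. *)
Definition chain_dir (R : realType) (n : nat) (v : nat -> 'rV[R]_n) (i : nat) :
    'rV[R]_n :=
  v i - (if i is j.+1 then v j else 0).

Lemma sum_chain_dir (R : realType) (n m : nat) (v : nat -> 'rV[R]_n) :
  \sum_(i < m.+1) chain_dir v i = v m.
Proof.
elim: m => [|m IH]; first by rewrite big_ord1 /chain_dir subr0.
by rewrite big_ord_recr IH /= addrC subrK.
Qed.

(** Each term is at most [2 p^2 + 2 q^2] with [p], [q] consecutive coordinates, and Bessel bounds
    both sums. The factor 4 is what turns the weight [L / 8] into smoothness [L]. *)
Lemma chain_dir_bessel (R : realType) (n m : nat) (v : nat -> 'rV[R]_n)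
    (z : 'rV[R]_n) : orthonormal_prefix m v ->
  \sum_(i < m) dot (chain_dir v i) z ^+ 2 <= 4 * dot z z.
Proof.
move=> vP; have B := bessel_inequality z vP.
pose y i := dot (v i) z.
pose y' i := if i is j.+1 then y j else 0.
have y'y : \sum_(i < m) y' i ^+ 2 <= \sum_(i < m) y i ^+ 2.
  case: m {vP B} => [|m]; first by rewrite !big_ord0.
  rewrite big_ord_recl big_ord_recr /= expr0n add0r lerDl sqr_ge0 //.
apply: (@le_trans _ _ (2 * \sum_(i < m) y i ^+ 2 + 2 * \sum_(i < m) y' i ^+ 2)).
  rewrite !mulr_sumr -big_split; apply: ler_sum => i _ /=.
  have -> : dot (chain_dir v i) z = y i - y' i.
    by rewrite /chain_dir dotBl; congr (_ - _); case: (i : nat); rewrite ?dot0l.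
  by move: (y i) (y' i) => p q; have := sqr_ge0 (p + q); nra.
by rewrite /y in y'y *; lra.
Qed.

Lemma smooth_chain (R : realType) (n m : nat) (L : R) (v : nat -> 'rV[R]_n)
    (c : nat -> R) (x0 : 'rV[R]_n) : 0 <= L -> orthonormal_prefix m v ->
  smooth_function L (least_squares m (L / 8) (chain_dir v) c x0).
Proof.
move=> L0 vP; split => [x|x y]; first exact: differentiable_least_squares.
rewrite !gradient_least_squares -sumrB.
pose w := \sum_(i < m) dot (chain_dir v i) (x - y) *: chain_dir v i.
rewrite (_ : \sum_(i < m) _ = (L / 4) *: w); last first.
  rewrite scaler_sumr; apply: eq_bigr => i _; rewrite scalerA -scalerBl.
  by congr (_ *: _); rewrite !dotBr; field.
have ww : dot w w =
    \sum_(i < m) dot (chain_dir v i) (x - y) * dot (chain_dir v i) w.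
  by rewrite {1}/w dot_suml; apply: eq_bigr => i _; rewrite dotZl.
have : dot w w <= 16 * dot (x - y) (x - y).
  have Bx := chain_dir_bessel (x - y) vP; have Bw := chain_dir_bessel w vP.
  (* Termwise [p q <= 2 p^2 + q^2 / 8]. By [chain_dir_bessel] the second sum contributes at most
     half of [dot w w], which is absorbed on the left. *)
  suff : dot w w <= 2 * \sum_(i < m) dot (chain_dir v i) (x - y) ^+ 2
      + 8^-1 * \sum_(i < m) dot (chain_dir v i) w ^+ 2 by lra.
  rewrite {1}ww !mulr_sumr -big_split; apply: ler_sum => i _ /=.
  move: (dot _ (x - y)) (dot _ w) => p q.
  by have := sqr_ge0 (4 * p - q); nra.
move=> wxy; rewrite !l2normE -[L in leRHS]ger0_norm // -sqrtr_sqr -sqrtrM ?sqr_ge0 //.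
apply: ler_wsqrtr; rewrite dotZl dotZr.
by have := sqr_ge0 L; nra.
Qed.

(** Cauchy-Schwarz against the all-ones vector, from the nonnegativity of the variance. *)
Lemma sqr_sum_le (R : realType) (m : nat) (r : 'I_m -> R) :
  (\sum_(i < m) r i) ^+ 2 <= m%:R * \sum_(i < m) r i ^+ 2.
Proof.
case: m r => [|m] r; first by rewrite big_ord0 expr0n mul0r.
set S := \sum_(i < _) r i; set Q := \sum_(i < _) r i ^+ 2.
have m0 : 0 < m.+1%:R :> R by rewrite ltr0n.
have : 0 <= \sum_(i < m.+1) (m.+1%:R * r i - S) ^+ 2.
  by apply: sumr_ge0 => i _; rewrite sqr_ge0.
have -> : \sum_(i < m.+1) (m.+1%:R * r i - S) ^+ 2 =
    m.+1%:R * (m.+1%:R * Q - S ^+ 2).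
  transitivity (\sum_(i < m.+1)
      (m.+1%:R ^+ 2 * r i ^+ 2 - 2 * m.+1%:R * S * r i + S ^+ 2)).
    by apply: eq_bigr => i _; ring.
  rewrite big_split sumrB /= -!mulr_sumr sumr_const card_ord -/S -/Q.
  by rewrite -mulr_natl; ring.
by rewrite pmulr_rge0 // subr_ge0.
Qed.

(** * Adaptive choice of the directions *)

(** Terms with [i <= s] involve only the shared directions. For [i > s] both [v i] and [v (i - 1)]
    vanish on [x - x0] and the offset is 0, so the coefficient is 0. *)
Lemma gradient_chain_local (R : realType) (n m : nat) (a b : R)
    (x0 x : 'rV[R]_n) (v v' : nat -> 'rV[R]_n) (s : nat) :
  (forall j, (s <= j)%N -> dot (v j) (x - x0) = 0) ->
  (forall j, (s <= j)%N -> dot (v' j) (x - x0) = 0) ->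
  (forall j, (j <= s)%N -> v j = v' j) ->
  gradient (least_squares m a (chain_dir v) (fun i => b *+ (i == 0%N)) x0) x =
  gradient (least_squares m a (chain_dir v') (fun i => b *+ (i == 0%N)) x0) x.
Proof.
move=> vx v'x vv'; rewrite !gradient_least_squares; apply: eq_bigr => -[i _] _ /=.
have [si|si] := leqP i s.
  suff -> : chain_dir v i = chain_dir v' i by [].
  rewrite /chain_dir vv' //; case: i si => // i si.
  by rewrite vv' // ltnW.
case: i si => // i si.
have si1 := leqW si; rewrite /chain_dir !dotBl !vx // !v'x //.
by rewrite (_ : b *+ _ = 0) // !subrr mulr0 !scale0r.
Qed.

(* [T h k] is the [k]-th test point of a fixed method run on [h]. *)
Definition causal (R : realType) (n : nat) (x0 : 'rV[R]_n)
    (T : ('rV[R]_n -> R) -> nat -> 'rV[R]_n) : Prop :=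
  (forall h, T h 0%N = x0) /\
  forall h h' k,
    (forall s, (s <= k)%N -> gradient h (T h s) = gradient h' (T h s)) ->
    T h k.+1 = T h' k.+1.

(** Induction on the number of chosen directions. Setting the others to 0 makes [h] a genuine
    objective on which the method can be run at every stage. *)
Lemma resisting_directions (R : realType) (n m i : nat) (a b : R)
    (x0 : 'rV[R]_n) (T : ('rV[R]_n -> R) -> nat -> 'rV[R]_n) :
  causal x0 T -> (m.*2 <= n)%N -> (i <= m)%N ->
  exists v : nat -> 'rV[R]_n,
    let h := least_squares m a (chain_dir v) (fun i => b *+ (i == 0%N)) x0 in
    [/\ orthonormal_prefix i v, (forall j, (i <= j)%N -> v j = 0) &
        forall s j, (s <= j)%N -> dot (v j) (T h s - x0) = 0].
Proof.
move=> [T0 Tc] mn; elim: i => [|i IH] im.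
  by exists (fun=> 0); split=> // s j _; rewrite dot0l.
have [v [vo v0 vT]] := IH (ltnW im); set h := least_squares _ _ _ _ _ in vT.
(* The new direction must avoid the [i] old ones and the [i + 1] displacements of the test points 0
   to [i]; since [i < m], these [2 i + 1] vectors are fewer than [n]. *)
pose w j := if (j < i)%N then v j else T h (j - i)%N - x0.
have [|z [zz zw]] := @exists_orthogonal_unit R n (i + i.+1) w.
  by apply: leq_trans mn; rewrite addnS addnn -doubleS leq_double.
have vz j : (j < i)%N -> dot (v j) z = 0.
  by move=> ji; rewrite -(zw j) ?ltn_addr // /w ji.
have Tz s : (s <= i)%N -> dot z (T h s - x0) = 0.
  move=> si; rewrite dotC -(zw (i + s)%N) ?ltn_add2l //.
  by rewrite /w ltnNge leq_addr /= addKn.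
pose v' j := if j == i then z else v j.
have v'T s j : (s <= i)%N -> (s <= j)%N -> dot (v' j) (T h s - x0) = 0.
  by move=> si sj; rewrite /v'; case: eqP => _; [exact: Tz | exact: vT].
exists v' => h'.
(* Adding [z] does not disturb the run up to index [i]: at an earlier point [r < i] the gradient
   sees only directions up to [r], where [v] and [v'] agree. *)
have TT s : (s <= i)%N -> T h' s = T h s.
  case: s => [|s] si; first by rewrite !T0.
  apply/esym/Tc => r rs; apply: (@gradient_chain_local _ _ _ _ _ _ _ _ _ r).
  - by move=> j; exact: vT.
  - by move=> j; apply: v'T; rewrite (leq_trans rs) // ltnW.
  - by move=> j jr; rewrite /v' ltn_eqF // (leq_ltn_trans jr) // (leq_ltn_trans rs).
split.
- move=> j k; rewrite !ltnS /v' => ji ki.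
  have [ej|jni] := eqVneq j i; have [ek|kni] := eqVneq k i.
  + by rewrite ej ek eqxx zz.
  + by rewrite ej dotC vz ?ltn_neqAle ?kni // eq_sym (negbTE kni).
  + by rewrite ek vz ?ltn_neqAle ?jni // (negbTE jni).
  + by rewrite vo // ltn_neqAle ?jni ?kni.
- by move=> j ij; rewrite /v' gtn_eqF // v0 // ltnW.
(* Beyond index [i] the test points may change, but then [j > i] and [v' j = 0]. *)
- move=> s j sj; have [si|si] := leqP s i; first by rewrite TT // v'T.
  by rewrite /v' gtn_eqF ?(leq_trans si) // v0 ?dot0l // ltnW // (leq_trans si).
Qed.

(** * Hard functions for a single objective *)

Lemma chain_hard (R : realType) (n m : nat) (L D e : R) (x0 : 'rV[R]_n)
    (T : ('rV[R]_n -> R) -> nat -> 'rV[R]_n) :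
  0 < L -> 0 < D -> causal x0 T -> (m.+1.*2 <= n)%N ->
  8 * m.+1%:R ^+ 2 * e < L * D ^+ 2 ->
  exists (h : 'rV[R]_n -> R) (xs : 'rV[R]_n),
    [/\ convex_function [set: 'rV[R]_n] h, smooth_function L h,
        l2ball x0 D xs, (forall z, l2ball x0 D z -> h xs <= h z) &
        forall k, (k <= m)%N -> e < h (T h k) - h xs].
Proof.
move=> L0 D0 Tc mn eLD; pose b := D / Num.sqrt m.+1%:R.
have m0 : 0 < m.+1%:R :> R by rewrite ltr0n.
have b2 : m.+1%:R * b ^+ 2 = D ^+ 2.
  by rewrite /b expr_div_n sqr_sqrtr ?ltW // mulrC divfK // gt_eqF.
have [v [vo _ vT]] := resisting_directions (L / 8) b Tc mn (leqnn m.+1).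
move: vT; set h := least_squares _ _ _ _ _ => vT.
have L8 : 0 <= L / 8 by rewrite divr_ge0 // ltW.
have h0 z : 0 <= h z.
  by apply: mulr_ge0 => //; apply: sumr_ge0 => i _; rewrite sqr_ge0.
pose p := \sum_(i < m.+1) v i.
have vp j : (j < m.+1)%N -> dot (v j) p = 1.
  move=> jm; rewrite /p dot_sumr (bigD1 (Ordinal jm)) //= big1 => [|i ij].
    by rewrite vo // eqxx addr0.
  by rewrite vo // -(inj_eq val_inj) /= eq_sym in ij *; rewrite (negbTE ij).
have hxs : h (x0 + b *: p) = 0.
  rewrite /h /least_squares big1 ?mulr0 // => -[i im] _ /=.
  rewrite addrAC subrr add0r dotZr /chain_dir dotBl.
  case: i im => [|i] im; first by rewrite dot0l vp // subr0 mulr1 subrr expr0n.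
  by rewrite (vp _ im) (vp _ (ltnW im)) subrr mulr0 subr0 expr0n.
exists h, (x0 + b *: p); split => //.
- exact: convex_least_squares.
- exact/smooth_chain/vo/ltW.
- rewrite /l2ball /= (l2norm_le _ (ltW D0)) addrAC subrr add0r dotZl dotZr.
  have -> : dot p p = m.+1%:R.
    rewrite {1}/p dot_suml (eq_bigr (fun=> 1)) ?sumr_const ?card_ord // => i _.
    exact: vp.
  by rewrite mulrA -expr2 mulrC b2.
- by move=> z _; rewrite hxs.
- move=> k km; rewrite hxs subr0.
  (* The residuals telescope to the last coordinate minus [b], which is [- b] because [k <= m]. *)
  have := sqr_sum_le (fun i : 'I_m.+1 => dot (chain_dir v i) (T h k - x0)
    - b *+ (i == 0%N :> nat)).
  rewrite sumrB -dot_suml sum_chain_dir vT // sub0r.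
  rewrite big_ord_recl big1 //= mulr1n addr0 sqrrN => Hb.
  have {Hb} : L * D ^+ 2 <= 8 * m.+1%:R ^+ 2 * h (T h k).
    rewrite -b2 /h /least_squares; move: Hb; set Q := \sum_(i < _) _ => Hb.
    have := ler_wpM2l (mulr_ge0 (ltW L0) (ltW m0)) Hb.
    by congr (_ <= _); field.
  move=> Hb; have := lt_le_trans eLD Hb.
  by rewrite ltr_pM2l // mulr_gt0 // exprn_gt0.
Qed.

(* Below the scale at which the chain is informative, the minimizer is put at
   the boundary of the ball, where the slope, hence the gap at [x0], is as large
   as one wishes. *)
Lemma one_step_hard (R : realType) (n : nat) (L D e : R) (x0 : 'rV[R]_n) :
  (0 < n)%N -> 0 < L -> 0 < D -> 0 < e ->
  exists (h : 'rV[R]_n -> R) (xs : 'rV[R]_n),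
    [/\ convex_function [set: 'rV[R]_n] h, smooth_function L h,
        l2ball x0 D xs, (forall z, l2ball x0 D z -> h xs <= h z) &
        e < h x0 - h xs].
Proof.
(* This [b] makes the gap [L / 8 * D * (2 b - D)] equal to [L / 8 * D ^+ 2 + 2 * e]. *)
move=> n0 L0 D0 e0; pose b := D + 8 * e / (L * D).
have [z [zz _]] := @exists_orthogonal_unit R n 0 (fun=> 0) n0.
pose v (i : nat) := z.
have vo : orthonormal_prefix 1 v by case=> [|//] [|//] _ _; rewrite eqxx.
pose h := least_squares 1 (L / 8) (chain_dir v) (fun=> b) x0.
have hE x : h x = L / 8 * (dot z (x - x0) - b) ^+ 2.
  by rewrite /h /least_squares big_ord1 /chain_dir subr0.
have L8 : 0 < L / 8 by rewrite divr_gt0.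
have bD : D < b by rewrite ltrDl !mulr_gt0 // invr_gt0 mulr_gt0.
have hxs : h (x0 + D *: z) = L / 8 * (D - b) ^+ 2.
  by rewrite hE addrAC subrr add0r dotZr zz mulr1.
exists h, (x0 + D *: z); split => //.
- exact/convex_least_squares/ltW.
- exact/smooth_chain/vo/ltW.
- by rewrite /l2ball /= (l2norm_le _ (ltW D0)) addrAC subrr add0r dotZl dotZr zz
    mulr1 -expr2.
- move=> x; rewrite /l2ball /= (l2norm_le _ (ltW D0)) => xD.
  rewrite hxs hE ler_pM2l //.
  have := bessel_inequality (x - x0) vo; rewrite big_ord1 /= => /le_trans/(_ xD).
  rewrite -[v _]/z; move: (dot z _) => t tD.
  (* Since [t <= D < b], moving [t] up to [D] only decreases the square. *)
  have {}tD : t <= D by rewrite leNgt; apply/negP => tD'; nra.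
  by nra.
- rewrite hxs hE subrr dotC dot0l sub0r sqrrN -mulrBr.
  have -> : L / 8 * (b ^+ 2 - (D - b) ^+ 2) = L / 8 * D ^+ 2 + 2 * e.
    by rewrite /b; field; rewrite !gt_eqF.
  have : 0 < L / 8 * D ^+ 2 by rewrite mulr_gt0 // exprn_gt0.
  lra.
Qed.

Lemma hard_function (R : realType) (n m : nat) (L D e : R) (x0 : 'rV[R]_n)
    (T : ('rV[R]_n -> R) -> nat -> 'rV[R]_n) :
  0 < L -> 0 < D -> 0 < e -> causal x0 T -> (m.+1.*2 <= n)%N ->
  m = 0%N \/ 8 * m.+1%:R ^+ 2 * e < L * D ^+ 2 ->
  exists (h : 'rV[R]_n -> R) (xs : 'rV[R]_n),
    [/\ convex_function [set: 'rV[R]_n] h, smooth_function L h,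
        l2ball x0 D xs, (forall z, l2ball x0 D z -> h xs <= h z) &
        forall k, (k <= m)%N -> e < h (T h k) - h xs].
Proof.
move=> L0 D0 e0 Tc mn [m0|]; last exact: chain_hard.
have n0 : (0 < n)%N by exact: leq_trans mn.
have [h [xs [h1 h2 h3 h4 h5]]] := one_step_hard x0 n0 L0 D0 e0.
exists h, xs; split => // k; rewrite m0 leqn0 => /eqP ->.
by rewrite Tc.1.
Qed.

(** Take [m + 1] to be the integer part of [t / 3] when positive: then
    [8 (m+1)^2 < 9 (m+1)^2 <= t^2], and [t / 3 < m + 2 <= 2 (m + 1)] yields the factor 1/6.
    Otherwise [t < 3] and [m = 0] suffices. *)
Lemma chain_length (R : realType) (L D e : R) : 0 < L -> 0 < D -> 0 < e ->
  exists m : nat,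
    (m = 0%N \/ 8 * m.+1%:R ^+ 2 * e < L * D ^+ 2) /\
    6^-1 * (Num.sqrt (L / e) * D) <= m.+1%:R.
Proof.
move=> L0 D0 e0; set t := Num.sqrt (L / e) * D.
have t0 : 0 <= t by rewrite mulr_ge0 ?sqrtr_ge0 // ltW.
have t2 : t ^+ 2 * e = L * D ^+ 2.
  by rewrite exprMn sqr_sqrtr ?divr_ge0 ?ltW // mulrAC divfK // gt_eqF.
have /truncn_itv/andP[] : 0 <= t / 3 by rewrite divr_ge0.
case: (Num.truncn _) => [|m] ? tm.
  by exists 0%N; split; [left | lra].
exists m; split.
  right; rewrite -t2 ltr_pM2r //.
  have m0 : 0 < m.+1%:R :> R by rewrite ltr0n.
  by nra.
have : 1 <= m.+1%:R :> R by rewrite ler1n.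
by rewrite -[m.+2]addn1 natrD in tm; lra.
Qed.

(** * From one objective to the bilevel problem *)

Lemma opt_value_attained (R : realType) (n : nat) (Z : set 'rV[R]_n)
    (h : 'rV[R]_n -> R) (xs : 'rV[R]_n) :
  argmin_on Z h xs -> opt_value Z h = h xs.
Proof.
move=> [Zxs hmin]; apply/le_anti/andP; split.
  apply: ge_inf; last by exists xs.
  by exists (h xs) => _ [z Zz <-]; exact: hmin.
by apply: lb_le_inf; [exists (h xs), xs | move=> _ [z Zz <-]; exact: hmin].
Qed.

Lemma argmin_on_cst (R : realType) (n : nat) (Z : set 'rV[R]_n) (c : R) :
  argmin_on Z (cst c) = Z.
Proof. by apply/seteqP; split => [x []|x Zx]. Qed.

Lemma convex_cst (R : realType) (n : nat) (c : R) :
  convex_function [set: 'rV[R]_n] (cst c).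
Proof.
by apply: convex_functionT => t x y _ /=; rewrite -mulrDl addrC subrK mul1r.
Qed.

Lemma smooth_cst (R : realType) (n : nat) (L c : R) : 0 <= L ->
  smooth_function L (cst c : 'rV[R]_n -> R).
Proof.
move=> L0; split => [x|x y]; first exact: differentiable_cst.
have -> : gradient (cst c) x = gradient (cst c) y.
  by apply/rowP => j; rewrite !mxE !derive_cst.
by rewrite subrr l2normE dot0l sqrtr0 l2normE mulr_ge0 ?sqrtr_ge0.
Qed.

Lemma smooth_bilevel_l2ball (R : realType) (n : nat) (Lf Lg D : R)
    (f g : 'rV[R]_n -> R) (x0 : 'rV[R]_n) : 0 <= D ->
  convex_function [set: 'rV[R]_n] f -> smooth_function Lf f ->
  convex_function [set: 'rV[R]_n] g -> smooth_function Lg g ->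
  smooth_bilevel_instance Lf Lg f g (l2ball x0 D).
Proof.
move=> D0 fc fs gc gs; split => //; split.
- by split=> // x; apply: differentiable_continuous; exact: fs.1.
- by split=> // x; apply: differentiable_continuous; exact: gs.1.
- exact: l2ball_convex.
- exact: l2ball_compact.
Qed.

(** Gives [causal] for the run of a method when one of the two objectives is held fixed. *)
Lemma transcript_local (R : realType) (n : nat) (A : first_order_method R n)
    (f g f' g' : 'rV[R]_n -> R) (x0 : 'rV[R]_n) (k : nat) :
  (forall s, (s <= k)%N ->
    let x := test_point A f g x0 s in
    gradient f x = gradient f' x /\ gradient g x = gradient g' x) ->
  transcript A f g x0 k = transcript A f' g' x0 k.
Proof.
elim: k => [|k IH] H /=.
  by have [/= fE gE] := H 0%N isT; rewrite /query fE gE.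
rewrite -IH => [|s sk]; last exact/H/leqW.
by have [/= fE gE] := H k.+1 (leqnn _); rewrite /query fE gE.
Qed.

Theorem theorem5p1 (R : realType) :
  exists c : R, 0 < c /\
  forall Lf Lg D ef eg : R,
    0 < Lf -> 0 < Lg -> 0 < D -> 0 < ef -> 0 < eg ->
  exists n : nat,
  forall A : first_order_method R n, zero_respecting A ->
  forall x0 : 'rV[R]_n,
  exists f g : 'rV[R]_n -> R,
    let Z := l2ball x0 D in
    [/\ smooth_bilevel_instance Lf Lg f g Z,
        (exists xs : 'rV[R]_n, bilevel_optimal f g Z xs /\ Z xs) &
        forall k : nat,
          weak_optimal ef eg f g Z (test_point A f g x0 k) ->
          c * (Num.max (Num.sqrt (Lf / ef)) (Num.sqrt (Lg / eg)) * D) <= k%:R].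
Proof.
exists 6^-1; split=> // Lf Lg D ef eg Lf0 Lg0 D0 ef0 eg0.
(* The level attaining the maximum carries the hard function and fixes the dimension, before the
   method and [x0] are given. *)
case: leP => _.
- have [m [mP mk]] := chain_length Lg0 D0 eg0.
  exists (m.+1.*2) => A _ x0.
  have Tc : causal x0 (fun h => test_point A (cst 0) h x0).
    split=> // h h' k hh' /=; congr (A _); apply: transcript_local => s sk.
    by split=> //; exact: hh'.
  have [g [xs [gc gs xsZ gmin gap]]] := hard_function Lg0 D0 eg0 Tc (leqnn _) mP.
  have gxs : argmin_on (l2ball x0 D) g xs by [].
  exists (cst 0), g; split.
  + apply: smooth_bilevel_l2ball => //; [exact: ltW|exact: convex_cst|].
    exact/smooth_cst/ltW.
  (* With a constant upper objective, every lower-level minimizer is optimal. *)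
  + by exists xs; split => //; split.
  + move=> k [_]; rewrite (opt_value_attained gxs) => gk.
    (* Test points 0 to [m] all miss the accuracy, so [k] is at least [m + 1]. *)
    apply: le_trans mk _; rewrite ler_nat ltnNge; apply/negP => km.
    by have := gap k km; rewrite ltNge gk.
- have [m [mP mk]] := chain_length Lf0 D0 ef0.
  exists (m.+1.*2) => A _ x0.
  have Tc : causal x0 (fun h => test_point A h (cst 0) x0).
    split=> // h h' k hh' /=; congr (A _); apply: transcript_local => s sk.
    by split=> //; exact: hh'.
  have [f [xs [fc fs xsZ fmin gap]]] := hard_function Lf0 D0 ef0 Tc (leqnn _) mP.
  have fxs : argmin_on (l2ball x0 D) f xs by [].
  exists f, (cst 0); split.
  + apply: smooth_bilevel_l2ball => //; [exact: ltW|exact: convex_cst|].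
    exact/smooth_cst/ltW.
  (* With a constant lower objective, the feasible set is the whole ball. *)
  + by exists xs; rewrite /bilevel_optimal argmin_on_cst.
  + move=> k [+ _]; rewrite argmin_on_cst (opt_value_attained fxs) => fk.
    apply: le_trans mk _; rewrite ler_nat ltnNge; apply/negP => km.
    by have := gap k km; rewrite ltNge fk.
Qed.
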